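(* Let $X$ be a Banach space with a Schauder basis, $\mathcal{F}$ a regular thin family, $M\subseteq\mathbb{N}$ infinite, and let $(e_n)_n$ be an $\mathcal{F}$-spreading model generated by a subordinated $\mathcal{F}$-subsequence $(x_s)_{s\in\mathcal{F}\upharpoonright M}$ in $X$ which is weakly convergent to $x\in X$. Then $(e_n)_n$ is also generated, as an $\mathcal{F}$-spreading model, by an $\mathcal{F}$-subsequence $(\widetilde{x}_s)_{s\in\mathcal{F}\upharpoonright L}$ in $X$ ($L\subseteq\mathbb{N}$ infinite) of the form $\widetilde{x}_s=x+x'_s$, where $(x'_s)_{s\in\mathcal{F}\upharpoonright L}$ is subordinated, weakly null and plegma disjointly supported.
   Context: $\mathbb{N}=\{1,2,\dots\}$. For $M\subseteq\mathbb{N}$ infinite, $M(k)$ is its $k$-th element; for a finite set $s$, $s(k)$ is its $k$-th element; $t\sqsubseteq s$ means initial segment. For a family $\mathcal{F}$ of finite subsets of $\mathbb{N}$ let $\widehat{\mathcal{F}}=\{t:\exists s\in\mathcal{F},\ t\sqsubseteq s\}$, $\mathcal{F}\upharpoonright M=\{s\in\mathcal{F}:s\subseteq M\}$ and $\widehat{\mathcal{F}}\upharpoonright M=\{t\in\widehat{\mathcal{F}}:t\subseteq M\}$. $\mathcal{F}$ is thin if no element is a proper initial segment of another. A family is regular if it is hereditary (closed under subsets), spreading (if $\{n_1<\dots<n_k\}$ is in it, $m_1<\dots<m_k$, $n_i\le m_i$ for all $i$, then $\{m_1,\dots,m_k\}$ is in it) and compact (its characteristic functions form a closed subset of $\{0,1\}^{\mathbb{N}}$).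 $\mathcal{F}$ is regular thin if it is thin and $\widehat{\mathcal{F}}$ is regular; regular thin families are assumed to contain a nonempty set. A tuple $(s_1,\dots,s_l)$ of nonempty finite subsets of $\mathbb{N}$ is plegma if $s_i(k)<s_j(k)$ whenever $i<j$ and $k\le\min(|s_i|,|s_j|)$, and $s_i(k)<s_j(k+1)$ for all $i,j$ and $k\le\min(|s_i|,|s_j|-1)$. An $\mathcal{F}$-subsequence $(x_s)_{s\in\mathcal{F}\upharpoonright M}$ in $X$ is a map $s\mapsto x_s$ from $\mathcal{F}\upharpoonright M$ to $X$. It converges weakly to $x$ if for every weak neighbourhood $U$ of $x$ there is $m$ with $x_s\in U$ for all $s\in\mathcal{F}\upharpoonright M$ with $\min s\ge m$ (weakly null: $x=0$). It is subordinated if there is a continuous map $\widehat{\varphi}:\widehat{\mathcal{F}}\upharpoonright M\to(X,w)$ (with $w$ the weak topology and $\widehat{\mathcal{F}}\upharpoonright M$ carrying the topology inherited from $\{0,1\}^{\mathbb{N}}$) such that $\widehat{\varphi}(s)=x_s$ for all $s\in\mathcal{F}\upharpoonright M$. It is plegma disjointly supported if every $x_s$ is finitely supported with respect to the Schauder basis and $\mathrm{supp}(x_{s_1})\cap\mathrm{supp}(x_{s_2})=\emptyset$ for every plegma pair $(s_1,s_2)$ in $\mathcal{F}\upharpoonright M$. Let $(e_n)_n$ be a Hamel basis of an infinite-dimensional seminormed space $(E,\|\cdot\|_* )$. $(x_s)_{s\in\mathcal{F}\upharpoonright M}$ generates $(e_n)_n$ as an $\mathcal{F}$-spreading model if there is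 a null sequence $(\delta_n)_n$ of positive reals such that $\big|\,\|\sum_{j=1}^k a_jx_{s_j}\|-\|\sum_{j=1}^k a_je_j\|_*\big|\le\delta_l$ for all $1\le k\le l$, all plegma $k$-tuples $(s_j)_{j=1}^k$ in $\mathcal{F}\upharpoonright M$ with $s_1(1)\ge M(l)$ and all $a_1,\dots,a_k\in[-1,1]$. *)

(* Defs.v *)
From HB Require Import structures.
From mathcomp Require Import all_boot all_order all_algebra finmap.
From mathcomp Require Import all_classical all_reals all_analysis.

Set Implicit Arguments.
Unset Strict Implicit.
Unset Printing Implicit Defensive.

Import Order.TTheory GRing.Theory Num.Theory.
Import numFieldNormedType.Exports.

Local Open Scope classical_set_scope.
Local Open Scope ring_scope.

(* The index set {1, 2, ...} is represented by [nat]: every notion below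
   depends only on its order, so starting at 0 is a mere relabelling. All
   enumerations are 0-based as well: the k-th element of a set, the members of
   a tuple, the Hamel and Schauder bases, and the sequence delta. *)

(* [elt s k] is s(k+1); it is meaningful for [k < #|` s|] only. *)
Definition elt (s : {fset nat}) (k : nat) : nat := nth 0%N (sort leq s) k.

Definition initial_segment (t s : {fset nat}) : Prop :=
  prefix (sort leq t) (sort leq s).

(* [set_elt M k] is M(k+1), the element of M with exactly k elements of M below
   it; [get] returns that element, which exists and is unique for M infinite. *)
Definition set_elt (M : set nat) (k : nat) : nat :=
  get [set n | M n /\ count (fun i => `[< M i >]) (iota 0 n) = k].

Definition hat (F : set {fset nat}) : set {fset nat} :=
  [set t | exists2 s, F s & initial_segment t s].

Definition restr (F : set {fset nat}) (M : set nat) : set {fset nat} :=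
  [set s | F s /\ [set` s] `<=` M].

Definition char_fun (s : {fset nat}) : cantor_space := fun n => n \in s.

(* Finite sets with the topology inherited from {0,1}^N. *)
Definition fset_space : topologicalType := initial_topology char_fun.

Definition thin (F : set {fset nat}) : Prop :=
  forall s t, F s -> F t -> initial_segment t s -> t = s.

Definition hereditary (F : set {fset nat}) : Prop :=
  forall s t : {fset nat}, F s -> (t `<=` s)%fset -> F t.

Definition spreading (F : set {fset nat}) : Prop :=
  forall s t : {fset nat}, F s -> #|` t| = #|` s| ->
    (forall k, (k < #|` s|)%N -> (elt s k <= elt t k)%N) -> F t.

Definition compact_family (F : set {fset nat}) : Prop :=
  closed (char_fun @` F).

Definition regular (F : set {fset nat}) : Prop :=
  [/\ hereditary F, spreading F & compact_family F].

Definition regular_thin (F : set {fset nat}) : Prop :=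
  [/\ thin F, regular (hat F) & exists2 s, F s & s != fset0].

Definition plegma (l : nat) (s : 'I_l -> {fset nat}) : Prop :=
  [/\ forall i, s i != fset0,
      forall (i j : 'I_l) k, (i < j)%N -> (k < #|` s i|)%N ->
        (k < #|` s j|)%N -> (elt (s i) k < elt (s j) k)%N
    & forall (i j : 'I_l) k, (k < #|` s i|)%N -> (k.+1 < #|` s j|)%N ->
        (elt (s i) k < elt (s j) k.+1)%N].

Definition continuous_dual (R : realType) (X : normedModType R) : Type :=
  {f : {linear X -> R^o} | continuous (f : X -> R^o)}.

Definition dual_eval (R : realType) (X : normedModType R) (x : X) :
    prod_topology (fun _ : continuous_dual X => R^o) :=
  fun f => sval f x.

(* X with its weak topology, the coarsest one making all the continuous linear
   functionals continuous. *)
Definition weak (R : realType) (X : normedModType R) : topologicalType :=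
  initial_topology (@dual_eval R X).

Definition schauder_basis (R : realType) (X : normedModType R) (b : nat -> X) :
    Prop :=
  forall x : X, exists! a : nat -> R, series (fun n => a n *: b n) @ \oo --> x.

Definition coordinates (R : realType) (X : normedModType R) (b : nat -> X)
    (x : X) : nat -> R :=
  get [set a : nat -> R | series (fun n => a n *: b n) @ \oo --> x].

Definition supp (R : realType) (X : normedModType R) (b : nat -> X) (x : X) :
    set nat :=
  [set n | coordinates b x n != 0].

Definition seminorm (R : realType) (E : lmodType R) (p : E -> R) : Prop :=
  (forall u v, p (u + v) <= p u + p v) /\ (forall a u, p (a *: u) = `|a| * p u).

(* A basis indexed by [nat], so that E is infinite-dimensional. *)
Definition hamel_basis (R : realType) (E : lmodType R) (e : nat -> E) : Prop :=
  (forall n (a : 'I_n -> R), \sum_(i < n) a i *: e i = 0 -> forall i, a i = 0) /\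
  (forall v, exists n, exists a : 'I_n -> R, v = \sum_(i < n) a i *: e i).

(* An F-subsequence indexed by [restr F M] is given by a total function on
   finite sets, of which only the values on [restr F M] are ever used. *)

Definition weakly_convergent (R : realType) (X : normedModType R)
    (F : set {fset nat}) (M : set nat) (x : {fset nat} -> X) (x0 : X) : Prop :=
  forall U : set X, nbhs (x0 : weak X) U ->
    exists m : nat, forall s, restr F M s -> (m <= elt s 0)%N -> U (x s).

Definition subordinated (R : realType) (X : normedModType R)
    (F : set {fset nat}) (M : set nat) (x : {fset nat} -> X) : Prop :=
  exists phi : fset_space -> weak X,
    {within restr (hat F) M : set fset_space, continuous phi} /\
    (forall s, restr F M s -> phi s = x s).

Definition plegma_disjointly_supported (R : realType) (X : normedModType R)
    (b : nat -> X) (F : set {fset nat}) (M : set nat) (x : {fset nat} -> X) :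
    Prop :=
  (forall s, restr F M s -> finite_set (supp b (x s))) /\
  (forall s : 'I_2 -> {fset nat}, (forall i, restr F M (s i)) -> plegma s ->
     supp b (x (s ord0)) `&` supp b (x (s ord_max)) = set0).

(* The tuples have length k+1, and the index l stands for l+1. *)
Definition generates (R : realType) (X : normedModType R)
    (F : set {fset nat}) (M : set nat) (x : {fset nat} -> X)
    (E : lmodType R) (p : E -> R) (e : nat -> E) : Prop :=
  exists delta : nat -> R,
    [/\ forall l, 0 < delta l,
        delta @ \oo --> (0 : R)
      & forall (k l : nat) (s : 'I_k.+1 -> {fset nat}) (a : 'I_k.+1 -> R),
          (k <= l)%N -> plegma s -> (forall j, restr F M (s j)) ->
          (set_elt M l <= elt (s ord0) 0)%N ->
          (forall j, -1 <= a j <= 1) ->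
          `| `|\sum_(j < k.+1) a j *: x (s j)| - p (\sum_(j < k.+1) a j *: e j) |
            <= delta l].

(* Main.v *)
(** Let [phi] be a weakly continuous extension of [x] to [restr (hat F) M]; then
[phi fset0 = x0], and for [s] in [F] the vector [x s - x0] is the sum over [n] in
[s] of the increments [phi (t U {n}) - phi t], where [t] consists of the elements
of [s] below [n]. For fixed [t] these tend weakly to 0 as [n] grows, so a sliding
hump argument yields [L = {g 0 < g 1 < ...}] and [N 0 <= N 1 <= ...] such that the
increment added at [n = g k] is within [3 * 4^-k] of its restriction to the basis
vectors with index in [[N k, N k.+1)]. The sum of these restrictions is [x' s].
Its support only involves the blocks attached to the elements of [s], and the two
sets of a plegma pair are disjoint. The error is uniformly small, which preserves
both weak continuity and the spreading model. Restricting to blocks requires the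
coordinate functionals to be continuous (Banach), obtained from Zabreiko's lemma. *)

From HB Require Import structures.
Require Import Defs.
From mathcomp Require Import all_boot all_order all_algebra finmap.
From mathcomp Require Import all_classical all_reals all_analysis.
From mathcomp Require Import ring lra zify.

Set Implicit Arguments.
Unset Strict Implicit.
Unset Printing Implicit Defensive.

Import Order.TTheory GRing.Theory Num.Theory.
Import numFieldNormedType.Exports.

Local Open Scope classical_set_scope.
Local Open Scope ring_scope.

(** * The topologies on finite sets and on X *)

(** The filter [G] is arbitrary so that the equivalence serves both neighbourhood filters and their
    traces on a subspace. *)
Lemma cvg_initial (S : choiceType) (T : topologicalType) (f : S -> T)
    (Y : Type) (G : set_system Y) (h : Y -> S) (x : S) : Filter G ->
  (h @ G --> (x : initial_topology f)) <-> ((f \o h) @ G --> f x).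
Proof.
move=> FG; split=> [hx|hx U [_ [[B oB <-] Bfx] BU]].
  exact: (cvg_comp h f hx (@initial_continuous S T f x)).
have : nbhs (f x) B by apply: open_nbhs_nbhs.
move=> /hx hB; apply: (@filterS _ G _ ((f \o h) @^-1` B) (h @^-1` U)) => [y By|].
  exact: BU.
exact: hB.
Qed.

Lemma cvg_prod_topology (I : Type) (T : I -> topologicalType)
    (Y : Type) (G : set_system Y) (h : Y -> prod_topology T)
    (x : prod_topology T) : Filter G ->
  (h @ G --> x) <-> (forall i, (fun y => h y i) @ G --> x i).
Proof.
move=> FG; split=> [/cvg_sup hx i|hx]; last first.
  by apply/cvg_sup => i; apply/cvg_initial; exact: hx.
by have /cvg_initial := hx i; apply.
Qed.

(** Cylinders form a neighbourhood base, the topology being induced from a product of discrete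
    two-point spaces: the filter [G] of cylinders at [t] converges to [t] coordinatewise, and
    conversely a cylinder is a finite intersection of coordinate conditions. *)
Lemma nbhs_fset_space (t : {fset nat}) (U : set {fset nat}) :
  nbhs (t : fset_space) U <->
  exists N, forall t' : {fset nat},
    (forall i, (i < N)%N -> (i \in t') = (i \in t)) -> U t'.
Proof.
split.
  pose G := filter_from [set: nat] (fun N => [set t' : {fset nat} |
    forall i, (i < N)%N -> (i \in t') = (i \in t)]).
  have FG : Filter G.
    apply: filter_from_filter; first by exists 0%N.
    move=> N1 N2 _ _; exists (maxn N1 N2) => // t' ht'.
    by split=> i iN; apply: ht'; rewrite leq_max iN ?orbT.
  suff Gt : id @ G --> (t : fset_space) by move=> /Gt [N _ NU]; exists N.
  apply/cvg_initial/cvg_prod_topology => i V /nbhs_singleton Vi.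
  by exists i.+1 => // t' /= ht'; rewrite /char_fun ht'.
move=> [N NU].
have ct : (fun t' : fset_space => char_fun t') @ (t : fset_space) --> char_fun t.
  exact: initial_continuous.
have ci i :
    (fun t' : fset_space => i \in (t' : {fset nat})) @ (t : fset_space) --> (i \in t).
  by have [/(_ ct i)] :=
    cvg_prod_topology char_fun (char_fun t) (nbhs_filter (t : fset_space)).
have : \forall t' \near (t : fset_space),
   forall i : 'I_N, ((i : nat) \in (t' : {fset nat})) = ((i : nat) \in t).
  apply: (@filter_forall fset_space 'I_N (fun i => [set t' : fset_space |
    ((i : nat) \in (t' : {fset nat})) = ((i : nat) \in t)]) _
    (nbhs_filter (t : fset_space))) => i.
  exact: (ci i [set (i : nat) \in t] (discrete_set1 _)).
apply: (@filterS fset_space _ (nbhs_filter (t : fset_space))) => t' ht'.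
apply: NU => i iN; exact: (ht' (Ordinal iN)).
Qed.

Lemma cvg_weak (R : realType) (X : normedModType R) (Y : Type)
    (G : set_system Y) (h : Y -> X) (x : X) : Filter G ->
  (h @ G --> (x : weak X)) <->
  (forall f : continuous_dual X, (fun y => sval f (h y) : R) @ G --> (sval f x : R)).
Proof.
move=> FG; split=> [|hx].
  by move=> /cvg_initial /cvg_prod_topology; exact.
by apply/cvg_initial/cvg_prod_topology; exact: hx.
Qed.

Lemma within_fset_space (A : set {fset nat}) (t : {fset nat}) (U : set {fset nat}) :
  (within (A : set fset_space) (nbhs (t : fset_space))) U <->
  exists N, forall t', A t' -> (forall i, (i < N)%N -> (i \in t') = (i \in t)) -> U t'.
Proof.
split=> [/nbhs_fset_space[N NU]|[N NU]].
  by exists N => t' At' tt'; exact: NU.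
by apply/nbhs_fset_space; exists N => t' tt' At'; exact: NU.
Qed.

(** * Continuity of Schauder coordinates *)

Section Zabreiko.
Context {R : realType} {X : completeNormedModType R} (q : X -> R).
Hypothesis q_sub : forall x y, q (x + y) <= q x + q y.
Hypothesis q_scale : forall (a : R) x, q (a *: x) = `|a| * q x.
(** Countable subadditivity, phrased through bounds on partial sums so that a divergent series of
    values of [q] needs no meaning. *)
Hypothesis q_sigma : forall (u : nat -> X) (x : X) (B : R),
  series u @ \oo --> x -> (forall n, series (q \o u) n <= B) -> q x <= B.

Let qN x : q (- x) = q x.
Proof. by rewrite -scaleN1r q_scale normrN1 mul1r. Qed.

(** The sublevel sets [A m] cover X, so by Baire the closure of one of them contains a ball;
    evenness and convexity of [q] recentre it at the origin. *)
Lemma countably_subadditive_approx :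
  exists m r : R, [/\ 0 <= m, 0 < r & forall y (e : R), `|y| < r -> 0 < e ->
    exists2 a, q a <= m & `|y - a| < e].
Proof.
pose A (m : nat) : set X := [set x | q x <= m%:R].
have [m ndm] : exists m, ~ dense (~` closure (A m)).
  apply: contrapT => /forallNP nd.
  have /Baire dI : forall m, open (~` closure (A m)) /\ dense (~` closure (A m)).
    move=> m; split; first exact/closed_openC/closed_closure.
    exact: contrapT (nd m).
  have [||x [_ xI]] := dI setT; [by exists 0|exact: openT|].
  apply: (xI (Num.truncn (q x)).+1 I); apply: subset_closure.
  by rewrite /A /= ltW ?truncnS_gt.
have [V [[x0 [oV Vx0]] VA]] := denseNE ndm.
have /nbhs_ballP[r /= r0 rV] : nbhs x0 V by apply: open_nbhs_nbhs.
have rA y (e : R) : `|y| < r -> 0 < e -> exists2 a, q a <= m%:R & `|x0 + y - a| < e.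
  move=> yr e0.
  have : closure (A m) (x0 + y).
    apply: contrapT => nA; suff : set0 (x0 + y) by [].
    rewrite -VA; split=> //; apply: rV.
    by rewrite -ball_normE /= opprD addNKr normrN.
  move=> /(_ _ (nbhsx_ballx _ _ e0))[a [Aa]].
  by rewrite -ball_normE; exists a.
exists m%:R, r; split=> // y e yr e0.
have [a1 qa1 ya1] := rA _ _ yr e0.
have [|a2 qa2 ya2] := rA (- y) e _ e0; first by rewrite normrN.
(* The ball found is centred at [x0]. Halving the difference of approximants of [x0 + y] and
   [x0 - y] cancels [x0] and keeps the bound [m] on [q]. *)
exists (2^-1 *: (a1 - a2)).
  rewrite q_scale gtr0_norm ?invr_gt0// ler_pdivrMl//.
  by rewrite (le_trans (q_sub _ _))// qN mulr_natl mulr2n lerD.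
have -> : y - 2^-1 *: (a1 - a2) = 2^-1 *: ((x0 + y - a1) - (x0 - y - a2)).
  rewrite -[in LHS](scale1r y) -[X in X *: y](@mulVf R 2)// -scalerA -scalerBr.
  congr (_ *: _); rewrite scaler_nat mulr2n !opprD !opprK.
  by rewrite [RHS](AC (3*3) ((1*4)*((2*5)*(3*6))))/= subrr add0r.
rewrite normrZ gtr0_norm ?invr_gt0// ltr_pdivrMl//.
by rewrite (le_lt_trans (ler_normB _ _))// mulr_natl mulr2n ltrD.
Qed.

(* Zabreiko's lemma: by Baire's theorem every small vector is approximated by
   vectors on which [q] is bounded; iterating writes it as a series to which
   [q_sigma] applies. *)
Lemma countably_subadditive_bounded :
  exists2 C : R, 0 < C & forall x, q x <= C * `|x|.
Proof.
have [m [r [m0 r0 mr]]] := countably_subadditive_approx.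
(* The pair holds the stage and the current remainder; the default 0 for remainders that are too
   large makes the choice total. *)
have step (ky : nat * X) : exists a, `|ky.2| < r * 2^-1 ^+ ky.1 ->
    q a <= m * 2^-1 ^+ ky.1 /\ `|ky.2 - a| < r * 2^-1 ^+ ky.1.+1.
  case: ky => k y /=.
  have [yk|] := boolP (`|y| < r * 2^-1 ^+ k); last by exists 0.
  have k0 : 0 < 2^-1 ^+ k :> R by rewrite exprn_gt0 ?invr_gt0.
  have [||a qa ya] := mr ((2^-1 ^+ k)^-1 *: y) (r * 2^-1).
  - by rewrite normrZ normfV gtr0_norm// ltr_pdivrMl// mulrC.
  - by rewrite mulr_gt0 ?invr_gt0.
  exists (2^-1 ^+ k *: a) => _; split.
    by rewrite q_scale gtr0_norm// mulrC ler_pM2r.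
  rewrite -[y in y - _](scalerKV (lt0r_neq0 k0)) -scalerBr normrZ gtr0_norm//.
  by rewrite exprSr mulrCA ltr_pM2l.
have [f fP] := choice step.
have qr x : `|x| < r -> q x <= m * 2.
  move=> xr.
  (* [y k] is what remains of [x] after [k] approximations, so the approximants sum to [x], while
     their [q]-values are at most [m * 2^-k] and add up to at most [m * 2]. *)
  pose y := fix y k := if k is k'.+1 then y k' - f (k', y k') else x.
  have yr k : `|y k| < r * 2^-1 ^+ k.
    elim: k => [|k IH]; first by rewrite expr0 mulr1.
    by have [] := fP (k, y k) IH.
  apply: (q_sigma (u := fun k => f (k, y k))).
    have -> : series (fun k => f (k, y k)) = fun n => x - y n.
      apply/funext => n; rewrite /series /=; elim: n => [|n IH].
        by rewrite big_nil subrr.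
      by rewrite big_nat_recr//= IH opprB -addrA (addrC (- _)).
    rewrite -[X in _ --> X]subr0; apply: cvgB; first exact: cvg_cst.
    apply/cvgr0Pnorm_le => e e0.
    have : (fun n => r * 2^-1 ^+ n) @ \oo --> (0 : R).
      by apply: cvg_geometric; rewrite gtr0_norm ?invr_gt0// invf_lt1// ltr1n.
    move/cvgr0Pnorm_le => /(_ _ e0); apply: filterS => n.
    by apply: le_trans; rewrite (le_trans (ltW (yr n)))// ler_norm.
  move=> n; apply: (@le_trans _ _ (series (geometric m 2^-1) n)).
    by apply: ler_sum => k _; have [] := fP (k, y k) (yr k).
  have := @geometric_le_lim R n m 2^-1 m0.
  rewrite invr_gt0 gtr0_norm ?invr_gt0// invf_lt1// ltr1n => /(_ (ltr0Sn _ _) isT).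
  move=> /le_trans; apply.
  have -> : 1 - 2^-1 = 2^-1 :> R by lra.
  by rewrite invrK.
(* Scaling [x] to norm [r / 2] brings it into the ball where [q <= m * 2]; the [+ 1] keeps the
   constant positive when [m] vanishes. *)
exists (m * 2 * (2 / r) + 1).
  by rewrite ltr_wpDl// !mulr_ge0// invr_ge0 ltW.
move=> x; have [->|x0] := eqVneq x 0.
  by rewrite -(scale0r 0) q_scale normr0 mul0r normrZ normr0 mul0r mulr0.
have nx : 0 < `|x| by rewrite normr_gt0.
apply: (@le_trans _ _ (m * 2 * (2 / r) * `|x|)); last first.
  by rewrite ler_wpM2r// lerDl.
have c0 : 0 < r / 2 / `|x| by rewrite !divr_gt0.
have := qr (r / 2 / `|x| *: x).
have r2 : r / 2 < r by lra.
rewrite normrZ gtr0_norm// divfK ?gt_eqF// => /(_ r2).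
rewrite q_scale gtr0_norm// -ler_pdivlMl// => /le_trans; apply.
by rewrite le_eqVlt; apply/orP; left; apply/eqP; field; rewrite !gt_eqF.
Qed.
End Zabreiko.

(** * Partial sums of a basis expansion *)

Section SchauderBasis.
Context {R : realType} {X : completeNormedModType R} (b : nat -> X).
Hypothesis hb : schauder_basis b.

Lemma coordinates_cvg x : series (fun n => coordinates b x n *: b n) @ \oo --> x.
Proof.
have [a [ax _]] := hb x.
by apply: (@getPex _ [set a | series (fun n => a n *: b n) @ \oo --> x]); exists a.
Qed.

Lemma coordinatesP x (a : nat -> R) :
  series (fun n => a n *: b n) @ \oo --> x -> coordinates b x = a.
Proof.
move=> ax; have [c [_ cU]] := hb x.
by rewrite -(cU a ax) -(cU _ (@coordinates_cvg x)).
Qed.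

Lemma coordinates_linear n : linear (fun x => coordinates b x n : R^o).
Proof.
move=> k x y; suff -> : coordinates b (k *: x + y) =
  (fun n => k * coordinates b x n + coordinates b y n) by [].
apply: coordinatesP.
have -> : series (fun n => (k * coordinates b x n + coordinates b y n) *: b n) =
    (fun N => k *: series (fun n => coordinates b x n *: b n) N +
     series (fun n => coordinates b y n *: b n) N).
  apply/funext => N; rewrite /series /= scaler_sumr -big_split /=.
  by apply: eq_bigr => i _; rewrite scalerDl scalerA.
by apply: cvgD; [apply: cvgZl_tmp|]; exact: coordinates_cvg.
Qed.

Lemma coordinatesD n x y :
  coordinates b (x + y) n = coordinates b x n + coordinates b y n.
Proof. by have := coordinates_linear n 1 x y; rewrite !scale1r. Qed.

Lemma coordinatesB n x y :
  coordinates b (x - y) n = coordinates b x n - coordinates b y n.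
Proof.
by have := coordinates_linear n (-1) y x; rewrite !scaleN1r ![- _ + _]addrC.
Qed.

Lemma coordinates0 n : coordinates b 0 n = 0.
Proof. by rewrite -(subrr 0) coordinatesB subrr. Qed.

Lemma coordinates_finite (a : nat -> R) N : (forall n, (N <= n)%N -> a n = 0) ->
  coordinates b (series (fun n => a n *: b n) N) = a.
Proof.
move=> aN; apply: coordinatesP; apply: cvg_near_cst; exists N => // n /= Nn.
rewrite /series /= (big_cat_nat (leq0n N) Nn)//= [X in _ + X]big1_seq ?addr0// => i.
by rewrite mem_index_iota => /and3P[_ Ni _]; rewrite aN// scale0r.
Qed.

(** A zero basis vector could carry any coefficient, giving 0 two expansions. *)
Lemma schauder_neq0 n : b n != 0.
Proof.
apply/eqP => bn.
pose a k : R := (k == n)%:R.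
have : coordinates b (series (fun k => a k *: b k) n.+1) = (fun=> 0).
  have -> : series (fun k => a k *: b k) n.+1 =
      series (fun k => (fun=> 0 : R) k *: b k) 0%N.
    rewrite /series /= big_nil big1// => i _; rewrite /a.
    by case: eqP => [->|_]; rewrite ?bn ?scaler0 ?scale0r.
  exact: coordinates_finite.
rewrite coordinates_finite => [/(congr1 (@^~ n))/eqP|k nk].
  by rewrite /a eqxx oner_eq0.
by rewrite /a gtn_eqF.
Qed.

Definition partial_sum (N : nat) (x : X) : X :=
  series (fun n => coordinates b x n *: b n) N.

Lemma partial_sum_linear N : linear (partial_sum N).
Proof.
move=> k x y; rewrite /partial_sum /series /= scaler_sumr -big_split /=.
by apply: eq_bigr => i _; rewrite (coordinates_linear i) scalerDl scalerA.
Qed.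

HB.instance Definition _ N :=
  GRing.isLinear.Build R X X _ (partial_sum N) (partial_sum_linear N).

Lemma partial_sum0 N : partial_sum N 0 = 0.
Proof. exact: linear0. Qed.

Lemma partial_sumB N x y : partial_sum N (x - y) = partial_sum N x - partial_sum N y.
Proof. exact: linearB. Qed.

(** The classical renorming, finite because the partial sums converge. Zabreiko's lemma is applied
    to it. *)
Let q (x : X) : R := sup (range (fun N => `|partial_sum N x|)).

Let q_sup x : has_sup (range (fun N => `|partial_sum N x|)).
Proof.
split; first by exists `|partial_sum 0 x|; exists 0%N.
have /cvg_seq_bounded : cvgn (fun N => partial_sum N x).
  by apply/cvg_ex; exists x; exact: coordinates_cvg.
by case=> M [_ /(_ (M + 1))]; rewrite ltrDl ltr01 => /(_ isT) h;
   exists (M + 1) => _ [N _ <-]; exact: h.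
Qed.

Let q_ub x N : `|partial_sum N x| <= q x.
Proof. by apply: sup_upper_bound; [exact: q_sup|exists N]. Qed.

Let q_le x r : (forall N, `|partial_sum N x| <= r) -> q x <= r.
Proof.
move=> h; apply: ge_sup; first by exists `|partial_sum 0 x|; exists 0%N.
by move=> _ [N _ <-].
Qed.

Let q_sub x y : q (x + y) <= q x + q y.
Proof.
apply: q_le => N; rewrite linearD (le_trans (ler_normD _ _))// lerD//; exact: q_ub.
Qed.

Let q_scale_le (a : R) x : q (a *: x) <= `|a| * q x.
Proof. by apply: q_le => N; rewrite linearZ normrZ ler_wpM2l// q_ub. Qed.

Let q_scale (a : R) x : q (a *: x) = `|a| * q x.
Proof.
apply/eqP; rewrite eq_le q_scale_le /=.
have [->|a0] := eqVneq a 0.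
  by rewrite normr0 mul0r (le_trans _ (q_ub _ 0%N)).
by rewrite -ler_pdivlMl ?normr_gt0// -normfV (le_trans _ (q_scale_le _ _))// scalerK.
Qed.

Let coord_le_q x n : `|coordinates b x n| <= 2 * q x / `|b n|.
Proof.
rewrite ler_pdivlMr ?normr_gt0 ?schauder_neq0// -normrZ.
have -> : coordinates b x n *: b n = partial_sum n.+1 x - partial_sum n x.
  by rewrite /partial_sum seriesSB.
by rewrite (le_trans (ler_normB _ _))// mulr_natl mulr2n lerD// q_ub.
Qed.

(** Continuity of the coordinates is still to be proved, so the coordinates of [x] cannot be
    computed as limits directly. Instead the limits [c n] of the summed coordinates of [u] are shown
    to expand [x], and uniqueness of the expansion identifies them. *)
Let q_sigma (u : nat -> X) (x : X) (B : R) :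
  series u @ \oo --> x -> (forall n, series (q \o u) n <= B) -> q x <= B.
Proof.
move=> ux uB.
have q0 y : 0 <= q y by rewrite (le_trans _ (q_ub y 0%N)).
have qu_homo : {homo series (q \o u) : n m / (n <= m)%N >-> n <= m}.
  by apply: nondecreasing_series => n _ /=.
have qu_cvg : cvgn (series (q \o u)).
  by apply: nondecreasing_is_cvgn => //; exists B => _ [n _ <-].
have co_cvg n : cvgn (series (fun k => coordinates b (u k) n : R^o)).
  apply: normed_cvg; apply: (@series_le_cvg _ _ (fun k => 2 / `|b n| * q (u k))).
  - by move=> k; exact: normr_ge0.
  - by move=> k; rewrite !mulr_ge0.
  - by move=> k; rewrite mulrAC; exact: coord_le_q.
  - have -> : series (fun k => 2 / `|b n| * q (u k)) =
        (2 / `|b n|) \*: (series (q \o u) : nat -> R^o).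
      by apply/funext => N; rewrite /series /= scaler_sumr.
    exact: is_cvgZl_tmp.
pose c n : R := limn (series (fun k => coordinates b (u k) n : R^o)).
pose T N := series (fun n => c n *: b n) N.
have PT N : (fun K => partial_sum N (series u K)) @ \oo --> T N.
  have -> : (fun K => partial_sum N (series u K)) =
      (fun K => series (fun n => series (fun k => coordinates b (u k) n) K *: b n) N).
    apply/funext => K; rewrite /series /= linear_sum exchange_big_nat/=.
    by apply: eq_bigr => k _; rewrite /partial_sum /series /= scaler_suml.
  rewrite /T /series /=; elim: N => [|N IH].
    under eq_fun do rewrite big_nil.
    by rewrite big_nil; exact: cvg_cst.
  under eq_fun do rewrite big_nat_recr//=.
  rewrite big_nat_recr//=; apply: cvgD => //.
  by apply: cvgZr_tmp; exact: co_cvg.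
have Pq N K K' : (K <= K')%N ->
    `|partial_sum N (series u K') - partial_sum N (series u K)|
    <= series (q \o u) K' - series (q \o u) K.
  move=> KK'; rewrite -linearB !sub_series_geq// linear_sum.
  by rewrite (le_trans (ler_norm_sum _ _ _))// ler_sum// => k _; exact: q_ub.
(* [K0] does not depend on [N]: the increments in [Pq] are controlled by the series of [q]-values
   alone. This uniformity permits exchanging the two limits. *)
have Ptail (e : R) : 0 < e -> exists K0, forall K, (K0 <= K)%N -> forall N,
    `|T N - partial_sum N (series u K)| <= e.
  move=> e0; have e2 : 0 < e / 2 by rewrite divr_gt0.
  have /cvgrPdist_le /(_ _ e2)[K0 _ K0P] := qu_cvg.
  exists K0 => K K0K N.
  have /cvgrPdist_le /(_ _ e2)[K1 _ K1P] := PT N.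
  have KK : (K <= maxn K K1)%N by rewrite leq_maxl.
  have := K1P (maxn K K1) (leq_maxr _ _); have := Pq N _ _ KK.
  have := K0P K K0K; rewrite /= ger0_norm ?subr_ge0; last exact: nondecreasing_cvgn_le.
  have := nondecreasing_cvgn_le qu_homo qu_cvg (maxn K K1).
  move=> h1 h2 h3 h4.
  rewrite (le_trans (ler_distD (partial_sum N (series u (maxn K K1))) _ _))//.
  rewrite [e](splitr e) lerD// (le_trans h3)// (le_trans _ h2)// lerD2r; exact: h1.
(* Three errors of [e / 3]: from [x] to a partial sum [z] of [u], from [z] to its truncation at [N],
   and from there to [T N]. *)
have Tx : T @ \oo --> x.
  apply/cvgrPdist_le => e e0; have e3 : 0 < e / 3 by rewrite divr_gt0.
  have [K0 K0P] := Ptail _ e3.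
  have /cvgrPdist_le /(_ _ e3)[K1 _ K1P] := ux.
  set K := maxn K0 K1; pose z := series u K.
  have /cvgrPdist_le /(_ _ e3)[N0 _ N0P] := @coordinates_cvg z.
  exists N0 => // N /= N0N.
  have h1 := K1P K (leq_maxr _ _).
  have h2 : `|z - partial_sum N z| <= e / 3 := N0P N N0N.
  have h3 := K0P K (leq_maxl _ _) N.
  rewrite (le_trans (ler_distD z _ _))//.
  rewrite (le_trans (lerD h1 (ler_distD (partial_sum N z) _ _)))//.
  rewrite (le_trans (lerD (lexx _) (lerD h2 (lexx _))))// distrC.
  rewrite (le_trans (lerD (lexx _) (lerD (lexx _) h3)))//; lra.
apply: q_le => N; rewrite /partial_sum (coordinatesP Tx) -/(T N).
apply/ler_addgt0Pr => e e0.
have [K /(_ K (leqnn _) N) h] := Ptail _ e0.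
rewrite -[T N](subrK (partial_sum N (series u K))) addrC (le_trans (ler_normD _ _))//.
rewrite lerD// (le_trans _ (uB K))//.
have := Pq N _ _ (leq0n K); rewrite /series /= !big_nil linear0 !subr0.
exact.
Qed.

Lemma partial_sum_bounded :
  exists2 C : R, 0 < C & forall N x, `|partial_sum N x| <= C * `|x|.
Proof.
have [C C0 qC] := countably_subadditive_bounded q_sub q_scale q_sigma.
by exists C => // N x; rewrite (le_trans (q_ub x N)).
Qed.

(** The n-th term of the expansion is a difference of two consecutive partial sums, both bounded by
    [C]. *)
Lemma coordinates_continuous n : continuous (fun x => coordinates b x n : R^o).
Proof.
have [C C0 PC] := partial_sum_bounded.
pose f : {linear X -> R^o} := HB.pack (fun x => coordinates b x n : R^o)
  (GRing.isLinear.Build R X R^o _ _ (coordinates_linear n)).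
suff : continuous f by [].
apply: bounded_linear_continuous; apply/linear_boundedP.
exists (2 * C / `|b n|); split; first exact: num_real.
move=> r Cr x; rewrite (le_trans _ (ler_wpM2r _ (ltW Cr)))//.
rewrite mulrAC ler_pdivlMr ?normr_gt0 ?schauder_neq0// -normrZ.
have -> : f x *: b n = partial_sum n.+1 x - partial_sum n x.
  by rewrite /partial_sum seriesSB.
by rewrite (le_trans (ler_normB _ _))// -mulrA mulr_natl mulr2n lerD.
Qed.

Lemma coordinates_partial_sum N x n :
  coordinates b (partial_sum N x) n = if (n < N)%N then coordinates b x n else 0.
Proof.
pose a n := if (n < N)%N then coordinates b x n else 0.
have -> : partial_sum N x = series (fun n => a n *: b n) N.
  by apply: eq_big_nat => k /andP[_ kN]; rewrite /a kN.
by rewrite coordinates_finite// /a => k Nk; rewrite ltnNge Nk.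
Qed.

Lemma coordinates_inj : injective (coordinates b).
Proof.
move=> x y xy; have := @coordinates_cvg x; rewrite xy.
move=> h; exact: (cvg_unique _ h (@coordinates_cvg y)).
Qed.

Definition coordinate_functional (n : nat) : continuous_dual X :=
  exist (fun f : {linear X -> R^o} => continuous (f : X -> R^o))
    (HB.pack (fun x => coordinates b x n : R^o)
      (GRing.isLinear.Build R X R^o _ _ (coordinates_linear n)))
    (@coordinates_continuous n).

(** Partial sum operators have finite rank and continuous coordinates, so they turn weak convergence
    into norm convergence. *)
Lemma weak_cvg_partial_sum (Y : Type) (G : set_system Y) (h : Y -> X) (x : X) N :
  Filter G -> (h @ G --> (x : weak X)) ->
  (fun y => partial_sum N (h y)) @ G --> partial_sum N x.
Proof.
move=> FG /cvg_weak hx; rewrite /partial_sum /series /=; elim: N => [|N IH].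
  under eq_fun do rewrite big_nil.
  by rewrite big_nil; exact: cvg_cst.
under eq_fun do rewrite big_nat_recr//=.
rewrite big_nat_recr//=; apply: cvgD => //; apply: cvgZr_tmp.
exact: (hx (coordinate_functional N)).
Qed.
End SchauderBasis.

(** * Finite sets of natural numbers *)

Lemma infinite_set_natP (A : set nat) :
  infinite_set A <-> forall m, exists2 n, A n & (m < n)%N.
Proof.
split=> [infA m|unb /finite_fsetP[B AB]].
  have [B BA cB] := infinite_set_fset m.+2 infA.
  apply: contrapT => nex; suff : (#|` B| <= m.+1)%N by rewrite leqNgt cB.
  rewrite -[m.+1](size_iota 0); apply: uniq_leq_size => // n nB.
  rewrite mem_iota /= add0n ltnS leqNgt; apply/negP => mn.
  by apply: nex; exists n => //; exact: BA.
have [n An] := unb (\max_(i <- B) i).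
by rewrite ltnNge leq_bigmax_seq//; move: An; rewrite AB.
Qed.

Definition count_below (A : set nat) (n : nat) :=
  count (fun i => `[< A i >]) (iota 0 n).

Lemma count_belowS (A : set nat) n :
  count_below A n.+1 = (count_below A n + `[< A n >])%N.
Proof. by rewrite /count_below -addn1 iotaD count_cat /= add0n addn0. Qed.

Lemma leq_count_below (A : set nat) m n :
  (m <= n)%N -> (count_below A m <= count_below A n)%N.
Proof.
elim: n => [|n IH]; first by rewrite leqn0 => /eqP ->.
by rewrite leq_eqVlt count_belowS => /predU1P[->|/IH]; rewrite ?count_belowS//; lia.
Qed.

Lemma leq_count_below_sub (A B : set nat) n :
  A `<=` B -> (count_below A n <= count_below B n)%N.
Proof.
by move=> AB; apply: sub_count => i /asboolP Ai; apply/asboolP; exact: AB.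
Qed.

Lemma count_below_unbounded (A : set nat) k :
  infinite_set A -> exists n, (k < count_below A n)%N.
Proof.
move=> infA; elim: k => [|k [m mk]].
  have [n An _] := (infinite_set_natP A).1 infA 0%N; exists n.+1.
  by rewrite count_belowS asboolT// addn1.
have [n An mn] := (infinite_set_natP A).1 infA m; exists n.+1.
by rewrite count_belowS asboolT// addn1 ltnS (leq_trans mk)// leq_count_below// ltnW.
Qed.

Lemma set_eltP (A : set nat) k : infinite_set A ->
  A (set_elt A k) /\ count_below A (set_elt A k) = k.
Proof.
move=> infA; apply: (@getPex _ [set n | A n /\ count_below A n = k]).
have := count_below_unbounded k infA => exk.
(* The least bound below which more than [k] elements lie is the successor of the element sought. *)
case: (ex_minnP exk) => -[|n] kn nmin; first by rewrite /count_below in kn.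
exists n; move: kn; rewrite count_belowS /=.
have : (count_below A n <= k)%N by rewrite leqNgt; apply/negP => /nmin; rewrite ltnn.
by case: asboolP => [An|_] /=; [split=> //|]; lia.
Qed.

(** Thinning a set pushes its enumeration up, so the condition on first elements in [generates] for
    a subset implies the one for the full set. *)
Lemma set_elt_sub (A B : set nat) k : infinite_set A -> infinite_set B ->
  A `<=` B -> (set_elt B k <= set_elt A k)%N.
Proof.
move=> infA infB AB; have [_ rA] := set_eltP k infA; have [BB rB] := set_eltP k infB.
rewrite leqNgt; apply/negP => lt.
have [An _] := set_eltP k infA; have := leq_count_below B lt.
rewrite count_belowS asboolT; last exact: AB.
by have := leq_count_below_sub (set_elt A k) AB; lia.
Qed.

Lemma leq_homo_ltn (g : nat -> nat) k : {homo g : i j / (i < j)%N} -> (k <= g k)%N.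
Proof. by move=> g_homo; elim: k => // k IH; rewrite (leq_ltn_trans IH)// g_homo. Qed.

Lemma infinite_range (g : nat -> nat) : {homo g : i j / (i < j)%N} ->
  infinite_set (range g).
Proof.
move=> g_homo; apply/infinite_set_natP => m; exists (g m.+1); first by exists m.+1.
exact: leq_homo_ltn.
Qed.

Lemma count_below_range (g : nat -> nat) k : {homo g : i j / (i < j)%N} ->
  (count_below (range g) (g k) <= k)%N.
Proof.
move=> gi; rewrite /count_below -size_filter.
rewrite -[leqRHS](size_iota 0) -(size_map g (iota 0 k)); apply: uniq_leq_size.
  by rewrite filter_uniq// iota_uniq.
move=> n; rewrite mem_filter mem_iota /= add0n => /andP[/asboolP[i _ <-] ik].
apply: map_f; rewrite mem_iota /= add0n ltnNge; apply/negP => ki.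
have : (g k <= g i)%N by rewrite (ltnW_homo gi).
by rewrite leqNgt ik.
Qed.

Lemma leq_set_elt_range (g : nat -> nat) k l : {homo g : i j / (i < j)%N} ->
  (set_elt (range g) l <= g k)%N -> (l <= k)%N.
Proof.
move=> gi lk; have [_ <-] := set_eltP l (infinite_range gi).
by rewrite (leq_trans (leq_count_below _ lk))// count_below_range.
Qed.

Lemma sorted_ltn_sort (s : {fset nat}) : sorted ltn (sort leq s).
Proof. by rewrite ltn_sorted_uniq_leq sort_uniq fset_uniq sort_sorted. Qed.

Lemma elt_in (s : {fset nat}) k : (k < #|` s|)%N -> elt s k \in s.
Proof. by move=> ks; rewrite -(mem_sort leq) mem_nth// size_sort. Qed.

Lemma leq_elt (s : {fset nat}) i j : (i <= j)%N -> (j < #|` s|)%N ->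
  (elt s i <= elt s j)%N.
Proof.
move=> ij js; apply: (sorted_leq_nth leq_trans leqnn) => //.
- by apply: sort_sorted; exact: leq_total.
- by rewrite inE size_sort (leq_ltn_trans ij).
- by rewrite inE size_sort.
Qed.

Lemma eltP (s : {fset nat}) n : n \in s -> exists2 k, (k < #|` s|)%N & elt s k = n.
Proof.
rewrite -(mem_sort leq) => ns; exists (index n (sort leq s)).
  by rewrite -(size_sort leq) index_mem.
by rewrite /elt nth_index.
Qed.

Lemma elt0_in (s : {fset nat}) : s != fset0 -> elt s 0 \in s.
Proof. by rewrite -cardfs_gt0; exact: elt_in. Qed.

Lemma elt0_le (s : {fset nat}) n : n \in s -> (elt s 0 <= n)%N.
Proof. by move=> /eltP[k ks <-]; rewrite leq_elt. Qed.

(** Suppose position [i] of the first set and position [j] of the second hold the same value. If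
    [i <= j], the first plegma inequality at [i] makes the former smaller; if [j < i], the second
    one at [j] makes the latter smaller. *)
Lemma plegma_disjoint (s : 'I_2 -> {fset nat}) n :
  plegma s -> n \in s ord0 -> n \in s ord_max -> False.
Proof.
move=> [_ lt01 lt10] /eltP[i i0 <-] /eltP[j j1 ji].
have [ij|ij] := leqP i j.
  have := lt01 ord0 ord_max i isT i0 (leq_ltn_trans ij j1).
  by have := leq_elt ij j1; lia.
have := lt10 ord_max ord0 j j1 (leq_ltn_trans ij i0).
by have := leq_elt ij i0; lia.
Qed.

(** Initial segments are cut by value, not by length, so that all sets can be cut at the same points
    [g k]. *)
Definition below (s : {fset nat}) (n : nat) : {fset nat} :=
  [fset i in s | (i < n)%N]%fset.

Lemma mem_below s n i : (i \in below s n) = (i \in s) && (i < n)%N.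
Proof. by rewrite !inE. Qed.

Lemma belowS_notin s n : n \notin s -> below s n.+1 = below s n.
Proof.
move=> ns; apply/fsetP => i; rewrite !mem_below ltnS leq_eqVlt.
by case: eqP => [->|//]; rewrite (negbTE ns).
Qed.

(** In a strictly increasing list, filtering by an upper bound cuts off a prefix. *)
Lemma below_initial_segment s n : initial_segment (below s n) s.
Proof.
have -> : initial_segment (below s n) s =
    prefix [seq i <- sort leq s | (i < n)%N] (sort leq s) :> Prop.
  congr (is_true (prefix _ _)); apply: (irr_sorted_eq ltn_trans ltnn).
  - exact: sorted_ltn_sort.
  - by apply: sorted_filter; [exact: ltn_trans|exact: sorted_ltn_sort].
  - by move=> i; rewrite mem_sort mem_filter mem_sort mem_below andbC.
have := sorted_ltn_sort s; elim: (sort leq s) => //= a l IH al.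
case: ifP => [an|an]; first by rewrite /= eqxx IH// (path_sorted al).
rewrite (_ : [seq i <- l | (i < n)%N] = [::]) ?prefix0s//.
apply/eqP; rewrite -[_ == _]negbK -has_filter -all_predC; apply/allP => i il /=.
have /allP/(_ _ il) : all (ltn a) l by apply: order_path_min al; exact: ltn_trans.
by move=> /= ai; rewrite -leqNgt (leq_trans _ (ltnW ai))// leqNgt an.
Qed.

Lemma hat_below F s n : hat F s -> hat F (below s n).
Proof.
move=> [s' Fs' ss']; exists s' => //.
exact: prefix_trans (below_initial_segment s n) ss'.
Qed.

Lemma restr_hat_below F L s n : restr (hat F) L s -> restr (hat F) L (below s n).
Proof.
move=> [Fs sL]; split; first exact: hat_below.
by move=> i /=; rewrite mem_below => /andP[/sL].
Qed.

Lemma restr_hat F L s : restr F L s -> restr (hat F) L s.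
Proof. by move=> [Fs sL]; split=> //; exists s => //; exact: prefix_refl. Qed.

Lemma restr_sub F L M s : L `<=` M -> restr F L s -> restr F M s.
Proof. by move=> LM [Fs sL]; split=> // i /sL /LM. Qed.

(** The empty set is an initial segment of the nonempty member, which thinness forbids. *)
Lemma regular_thin_neq0 F s : regular_thin F -> F s -> s != fset0.
Proof.
move=> [thinF _ [t Ft t0]] Fs; apply/eqP => s0.
suff st : s = t by rewrite -st s0 eqxx in t0.
apply: thinF => //; rewrite s0 /initial_segment.
have -> : sort leq (fset0 : {fset nat}) = [::].
  by apply/size0nil; rewrite size_sort cardfs0.
exact: prefix0s.
Qed.

(** Only finitely many [t] lie below [m], so the largest of their thresholds serves them all. *)
Lemma finite_uniform_bound m (Q : {fset nat} -> nat -> Prop) :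
  (forall t, exists n0, forall n, (n0 <= n)%N -> Q t n) ->
  exists n0, forall n t, (n0 <= n)%N -> (forall i, i \in t -> (i < m)%N) -> Q t n.
Proof.
move=> /choice[f fP].
exists (\max_(t <- fpowerset [fset i in iota 0 m]%fset) f t) => n t n0n tm.
apply: fP; rewrite (leq_trans _ n0n)//; apply: leq_bigmax_seq => //.
by rewrite fpowersetE; apply/fsubsetP => i /tm im; rewrite !inE mem_iota add0n.
Qed.

(** * The sliding hump *)

Section Blocks.
Context {R : realType} {X : completeNormedModType R} (b : nat -> X).
Hypothesis hb : schauder_basis b.
Context (F : set {fset nat}) (M : set nat) (phi : {fset nat} -> X).
Hypothesis phi_cont :
  {within restr (hat F) M : set fset_space, continuous (phi : fset_space -> weak X)}.

(** As [n] grows, [t] with [n] added converges to [t], so the increment of [phi] tends weakly to 0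
    and its partial sum in norm; finiteness makes this uniform in [t]. *)
Lemma head_small m N (e : R) : 0 < e ->
  exists n0, forall n t, (n0 <= n)%N -> (forall i, i \in t -> (i < m)%N) ->
    restr (hat F) M (n |` t)%fset ->
    `|partial_sum b N (phi (n |` t)%fset - phi t)| <= e.
Proof.
move=> e0; have [|n0 n0P] := @finite_uniform_bound m (fun t n =>
    restr (hat F) M (n |` t)%fset -> restr (hat F) M t ->
    `|partial_sum b N (phi (n |` t)%fset - phi t)| <= e).
  move=> t; have [At|nAt] := pselect (restr (hat F) M t); last by exists 0%N.
  have := (subspace_continuousP _ _).1 phi_cont t At.
  move/(@weak_cvg_partial_sum _ _ b hb fset_space _ _ _ N (within_filter _ (nbhs_filter _))).
  move/(@cvgrPdistC_le _ _ _ _ (within_filter _ (nbhs_filter _)))/(_ e e0)/within_fset_space.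
  move=> [n0 n0P]; exists n0 => n n0n Ant _; rewrite (partial_sumB hb); apply: n0P => //.
  by move=> i i0; rewrite in_fset1U ltn_eqF// (leq_trans i0).
(* With [n] above all of [t], the set [t] is an initial segment of the enlarged set and hence again
   in [hat F]. *)
exists (maxn n0 m) => n t; rewrite geq_max => /andP[n0n mn] tm An.
apply: n0P => //; have := restr_hat_below n An; congr (restr _ _ _).
apply/fsetP => i; rewrite mem_below in_fset1U; case: eqP => [->|_] /=.
  by rewrite ltnn; apply/esym/negP => /tm; rewrite ltnNge mn.
by case it : (i \in t) => //=; rewrite (leq_trans (tm i it)).
Qed.

Lemma tail_small m N (e : R) : 0 < e ->
  exists2 N', (N <= N')%N & forall t, (forall i, i \in t -> (i < m)%N) ->
    `|phi t - partial_sum b N' (phi t)| <= e.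
Proof.
move=> e0; have [|n0 n0P] := @finite_uniform_bound m (fun t n =>
    `|phi t - partial_sum b n (phi t)| <= e).
  move=> t; have /cvgrPdist_le/(_ _ e0)[n0 _ n0P] := @coordinates_cvg _ _ b hb (phi t).
  by exists n0.
by exists (maxn n0 N) => [|t tm]; [exact: leq_maxr|rewrite n0P// leq_maxl].
Qed.

(** Points and cuts are chosen alternately: [g k] so late that the increments it causes are small
    before [N k], then [N k.+1] so late that every [phi t] with [t] up to [g k] is small beyond
    it. *)
Lemma block_sequence : infinite_set M ->
  exists (g N : nat -> nat), [/\ {homo g : i j / (i < j)%N},
    forall k, M (g k), forall k, (N k <= N k.+1)%N &
    forall k s, restr (hat F) (range g) s ->
      let y := phi (below s (g k).+1) - phi (below s (g k)) in
      `|y - (partial_sum b (N k.+1) y - partial_sum b (N k) y)| <= 3 * 4^-1 ^+ k].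
Proof.
move=> infM.
have e0 k : 0 < 4^-1 ^+ k :> R by rewrite exprn_gt0// invr_gt0.
(* The state consists of the stage, a strict upper bound for the points chosen so far, and the
   current cut. *)
have step (st : nat * (nat * nat)) : exists nN : nat * nat,
    [/\ (st.2.1 <= nN.1)%N, M nN.1, (st.2.2 <= nN.2)%N &
    (forall t, (forall i, i \in t -> (i < st.2.1)%N) ->
      restr (hat F) M (nN.1 |` t)%fset ->
      `|partial_sum b st.2.2 (phi (nN.1 |` t)%fset - phi t)| <= 4^-1 ^+ st.1) /\
    (forall t, (forall i, i \in t -> (i < nN.1.+1)%N) ->
      `|phi t - partial_sum b nN.2 (phi t)| <= 4^-1 ^+ st.1)].
  case: st => k [m N] /=.
  have [n0 n0P] := head_small m N (e0 k).
  have [n Mn] := (infinite_set_natP M).1 infM (maxn m n0).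
  rewrite gtn_max => /andP[mn n0n].
  have [N' NN' N'P] := tail_small n.+1 N (e0 k).
  exists (n, N'); split=> //=; first exact: ltnW.
  by split=> // t; apply: n0P; exact: ltnW.
have [f fP] := choice step.
pose st := fix st k : nat * nat :=
  if k is k'.+1 then ((f (k', st k')).1.+1, (f (k', st k')).2) else (0%N, 0%N).
pose g k := (f (k, st k)).1.
have gS k : (g k < g k.+1)%N by have [] := fP (k.+1, st k.+1).
have ghom : {homo g : i j / (i < j)%N} by apply: homo_ltn => //; exact: ltn_trans.
have gM k : M (g k) by have [] := fP (k, st k).
have stg j k : (j < k)%N -> (g j < (st k).1)%N.
  by case: k => // k jk; rewrite /= ltnS -/(g k) (ltnW_homo ghom).
exists g, (fun k => (st k).2); split=> //.
  by move=> k; have [] := fP (k, st k).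
move=> k s As /=; set y := phi (below s (g k).+1) - phi (below s (g k)).
have cutm i : i \in below s (g k) -> (i < (st k).1)%N.
  rewrite mem_below => /andP[/(proj2 As)[j _ <-]].
  move=> gjk; apply: stg; rewrite ltnNge; apply/negP => kj.
  by move: gjk; rewrite ltnNge (ltnW_homo ghom).
have [_ _ _ [headP tailP]] := fP (k, st k); rewrite -/(g k) /= in headP tailP.
have [gs|gs] := boolP (g k \in s); last first.
  have -> : y = 0 by rewrite /y belowS_notin// subrr.
  by rewrite !(partial_sum0 hb) !subr0 normr0 mulr_ge0// ltW.
have uE : below s (g k).+1 = (g k |` below s (g k))%fset.
  apply/fsetP => i; rewrite in_fset1U !mem_below ltnS leq_eqVlt.
  by case: eqP => [->|//]; rewrite gs.
have h1 : `|partial_sum b (st k).2 y| <= 4^-1 ^+ k.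
  rewrite /y uE; apply: headP => //; rewrite -uE; apply: restr_hat_below.
  by apply: restr_sub As => _ [j _ <-].
have h2 : `|phi (below s (g k).+1) -
    partial_sum b (st k.+1).2 (phi (below s (g k).+1))| <= 4^-1 ^+ k.
  by apply: tailP => i; rewrite mem_below => /andP[].
have h3 : `|phi (below s (g k)) -
    partial_sum b (st k.+1).2 (phi (below s (g k)))| <= 4^-1 ^+ k.
  by apply: tailP => i; rewrite mem_below ltnS => /andP[_ /ltnW].
(* Outside its block, [y] has a head before [N k] and a tail beyond [N k.+1]; the tail is a
   difference of tails of two values of [phi]. This gives the factor 3. *)
rewrite opprB addrCA addrC.
have -> : y - partial_sum b (st k.+1).2 y =
  (phi (below s (g k).+1) - partial_sum b (st k.+1).2 (phi (below s (g k).+1)))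
  - (phi (below s (g k)) - partial_sum b (st k.+1).2 (phi (below s (g k)))).
  by rewrite /y (partial_sumB hb) !opprB [LHS](AC (2*2) ((1*4)*(3*2))).
rewrite (le_trans (ler_normD _ _))// (le_trans (lerD (ler_normB _ _) (lexx _)))//.
lra.
Qed.
End Blocks.

(** * The block vectors and their error *)

Section Perturbation.
Context {R : realType} {X : completeNormedModType R} (b : nat -> X).
Hypothesis hb : schauder_basis b.
Context (F : set {fset nat}) (phi : {fset nat} -> X) (g N : nat -> nat).
Hypothesis g_homo : {homo g : i j / (i < j)%N}.
Hypothesis N_le : forall k, (N k <= N k.+1)%N.

Definition increment k s := phi (below s (g k).+1) - phi (below s (g k)).
Definition block k y := partial_sum b (N k.+1) y - partial_sum b (N k) y.
(** Since [k <= g k], this exceeds every [k] with [g k] in [s], so the sum in [hump] omits only zero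
    terms. *)
Definition blocks_below (s : {fset nat}) := (\max_(i <- s) i).+1.
(** The vector [x' s], defined for every finite [s] so that it is also its own extension to
    [hat F]. *)
Definition hump s := series (fun k => block k (increment k s)) (blocks_below s).

Lemma block0 k : block k 0 = 0.
Proof. by rewrite /block !(partial_sum0 hb) subr0. Qed.

Let N_homo : {homo N : i j / (i <= j)%N}.
Proof. by apply: homo_leq => //; exact: leq_trans. Qed.

Let leq_g k : (k <= g k)%N.
Proof. exact: leq_homo_ltn. Qed.

Lemma lt_blocks_below s k : g k \in s -> (k < blocks_below s)%N.
Proof. by move=> gs; rewrite ltnS (leq_trans (leq_g k))// leq_bigmax_seq. Qed.

Lemma increment0 k s : g k \notin s -> increment k s = 0.
Proof. by move=> gs; rewrite /increment belowS_notin// subrr. Qed.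

Lemma humpE s K : (blocks_below s <= K)%N ->
  hump s = series (fun k => block k (increment k s)) K.
Proof.
move=> sK; rewrite /hump /series /= (big_cat_nat (leq0n _) sK)/=.
rewrite [X in _ + X]big1_seq ?addr0// => k; rewrite mem_index_iota => /and3P[_ bk _].
rewrite increment0 ?block0//; apply/negP => /lt_blocks_below.
by rewrite ltnNge bk.
Qed.

Lemma hump_supp s n : supp b (hump s) n ->
  exists2 k, (N k <= n < N k.+1)%N & g k \in s.
Proof.
rewrite /supp /= => sn; apply: contrapT => nex; move/eqP : sn; apply.
rewrite /hump; elim: (blocks_below s) => [|K IH].
  by rewrite /series /= big_nil (coordinates0 hb).
rewrite seriesSr (coordinatesD hb) IH add0r.
have [gs|gs] := boolP (g K \in s); last by rewrite increment0// block0 (coordinates0 hb).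
rewrite /block (coordinatesB hb) !(coordinates_partial_sum hb).
have := N_le K.
case: ltnP => n1; case: ltnP => n2 NK; rewrite ?subrr//.
- by exfalso; apply: nex; exists K => //; rewrite n1 n2.
- by move: (leq_trans n2 NK); rewrite ltnNge n1.
Qed.

Lemma hump_finite_supp s : finite_set (supp b (hump s)).
Proof.
apply: (@sub_finite_set _ _ `I_(N (blocks_below s))); last exact: finite_II.
move=> n /hump_supp[k /andP[_ nk] /lt_blocks_below ks] /=.
by rewrite (leq_trans nk)// N_homo.
Qed.

(** Blocks are successive intervals, so a common coordinate lies in a single block [k], and then
    [g k] would belong to both sets. *)
Lemma hump_plegma_disjoint (s : 'I_2 -> {fset nat}) : plegma s ->
  supp b (hump (s ord0)) `&` supp b (hump (s ord_max)) = set0.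
Proof.
move=> ps; rewrite -subset0 => n.
move=> [/hump_supp[k /andP[k1 k2] gk] /hump_supp[l /andP[l1 l2] gl]].
suff kl : k = l by apply: (plegma_disjoint ps gk); rewrite kl.
by apply/eqP; rewrite eqn_leq; apply/andP; split; rewrite leqNgt; apply/negP;
  move=> lt; have := N_homo lt; lia.
Qed.

Let A := restr (hat F) (range g).

(** No element of [s] lies strictly between [g k] and [g k.+1]; hence the increments telescope. *)
Lemma below_range s k : A s -> below s (g k).+1 = below s (g k.+1).
Proof.
move=> [_ sg]; apply/fsetP => i; rewrite !mem_below; case si : (i \in s) => //=.
have [j _ <-] := sg _ si; rewrite ltnS.
by rewrite (leqW_mono (leq_mono g_homo)) (leq_mono g_homo).
Qed.

Lemma increment_sum s K : A s -> (blocks_below s <= K)%N ->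
  series (fun k => increment k s) K = phi s - phi fset0.
Proof.
move=> As sK; rewrite /series /=.
under eq_bigr do rewrite /increment (below_range _ As).
rewrite (@telescope_sumr _ 0 K (fun k => phi (below s (g k))))//; congr (phi _ - phi _).
  apply/fsetP => i; rewrite mem_below; case si : (i \in s) => //=.
  by rewrite (leq_trans _ (leq_g K))// (leq_trans _ sK)// ltnS leq_bigmax_seq.
apply/fsetP => i; rewrite mem_below in_fset0; apply/negP => /andP[si].
have [j _ <-] := (proj2 As) _ si.
by rewrite ltnNge (ltnW_homo g_homo).
Qed.

Hypothesis increment_near : forall k s, A s ->
  `|increment k s - block k (increment k s)| <= 3 * 4^-1 ^+ k.

Definition error s := phi s - phi fset0 - hump s.

Lemma errorE s K : A s -> (blocks_below s <= K)%N ->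
  error s = series (fun k => increment k s - block k (increment k s)) K.
Proof.
move=> As sK; rewrite /error -(increment_sum As sK) (humpE sK).
by rewrite /series /= -sumrB.
Qed.

(** Terms with [k < l] depend only on the elements below [g l] and cancel. The estimate yields norm
    continuity of [error] and, for [t] empty, its smallness far out. *)
Lemma error_dist s t l : A s -> A t ->
  (forall i, (i < g l)%N -> (i \in s) = (i \in t)) ->
  `|error s - error t| <= 8 * 4^-1 ^+ l.
Proof.
move=> As At st; pose K := maxn l (maxn (blocks_below s) (blocks_below t)).
have lK : (l <= K)%N by rewrite leq_maxl.
rewrite (@errorE s K)// ?(@errorE t K)//; try by rewrite /K !leq_max leqnn ?orbT.
rewrite /series /= -sumrB (big_cat_nat (leq0n _) lK)/=.
rewrite [X in X + _]big1_seq ?add0r => [|k]; last first.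
  rewrite mem_index_iota => /and3P[_ _ kl].
  suff -> : increment k s = increment k t by rewrite subrr.
  have E m : (m <= g l)%N -> below s m = below t m.
    move=> ml; apply/fsetP => i; rewrite !mem_below.
    by case im : (i < m)%N; rewrite ?andbF// st// (leq_trans im).
  by rewrite /increment !E// ?g_homo// ltnW// g_homo.
rewrite (le_trans (ler_norm_sum _ _ _))//.
(* Each term is at most [6 * 4^-k], which is the decrease of [8 * 4^-k] from [k] to [k + 1]. *)
apply: (@le_trans _ _ (\sum_(l <= k < K) (- (8 * 4^-1 ^+ k.+1) - - (8 * 4^-1 ^+ k)))).
  apply: ler_sum => k _; rewrite (le_trans (ler_normB _ _))//.
  rewrite (le_trans (lerD (increment_near k As) (increment_near k At)))//.
  by rewrite exprS; lra.
rewrite (@telescope_sumr _ l K (fun k => - (8 * 4^-1 ^+ k)))// opprK gerDr oppr_le0.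
by rewrite mulr_ge0// exprn_ge0// invr_ge0.
Qed.

Lemma hump_set0 : hump fset0 = 0.
Proof.
rewrite /hump /series /= big1// => k _; rewrite increment0 ?block0//.
Qed.

Lemma error_set0 : error fset0 = 0.
Proof. by rewrite /error hump_set0 subrr subr0. Qed.

(** [hump] is [phi] minus a constant minus [error], and [error] is norm continuous on [A]. *)
Lemma hump_weak_continuous :
  {within A : set fset_space, continuous (phi : fset_space -> weak X)} ->
  {within A : set fset_space, continuous (hump : fset_space -> weak X)}.
Proof.
move=> phi_cont; apply/subspace_continuousP => t At.
have FA : Filter (within (A : set fset_space) (nbhs (t : fset_space))).
  exact: (within_filter _ (nbhs_filter _)).
have phit := (subspace_continuousP _ _).1 phi_cont t At.
have errt : error @ within (A : set fset_space) (nbhs (t : fset_space)) --> error t.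
  apply/cvgrPdist_le => e e0.
  have : (fun n => 8 * 4^-1 ^+ n : R) @ \oo --> (0 : R).
    by apply: cvg_geometric; rewrite gtr0_norm ?invr_gt0// invf_lt1// ltr1n.
  move/cvgr0Pnorm_le => /(_ _ e0)[l _ /(_ l (leqnn _))] /= le.
  apply/within_fset_space; exists (g l) => u Au ut.
  rewrite (le_trans _ (le_trans (ler_norm _) le))//; apply: error_dist => // i il.
  by rewrite ut.
have humpE' s : hump s = phi s - phi fset0 - error s.
  by rewrite /error opprB addrCA subrr addr0.
apply/cvg_weak => f.
have ft := (cvg_weak _ _ _).1 phit f.
have -> : (fun s : fset_space => sval f (hump s)) =
   (fun s => sval f (phi s) - sval f (phi fset0) - sval f (error s)).
  by apply/funext => s; rewrite humpE' !linearB.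
have -> : (sval f (from_subspace A hump t) : R) =
    sval f (phi t) - sval f (phi fset0) - sval f (error t).
  by rewrite -!linearB -humpE'.
apply: cvgB; last exact: (cvg_comp _ _ errt (svalP f _)).
apply: cvgB; first exact: ft.
exact: (@cvg_cst R^o).
Qed.

End Perturbation.

(** * Stability of spreading models under small perturbations *)

Lemma generates_perturb (R : realType) (X : completeNormedModType R)
    (F : set {fset nat}) (M : set nat) (g : nat -> nat)
    (E : lmodType R) (p : E -> R) (e : nat -> E) (x y : {fset nat} -> X) :
  infinite_set M -> {homo g : i j / (i < j)%N} -> range g `<=` M ->
  (forall l s, restr F (range g) s -> (forall i, i \in s -> (g l <= i)%N) ->
    `|x s - y s| <= 8 * 4^-1 ^+ l) ->
  generates F M x p e -> generates F (range g) y p e.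
Proof.
move=> infM g_homo gM xy [delta [delta0 delta_cvg deltaP]].
have ginf := infinite_range g_homo.
have c0 l : 0 < 8 * 2^-1 ^+ l :> R by rewrite mulr_gt0// exprn_gt0// invr_gt0.
(* At most [l + 1 <= 2^l] vectors, each moved by at most [8 * 4^-l], add an error of at most
   [8 * 2^-l]. *)
exists (fun l => delta l + 8 * 2^-1 ^+ l); split.
- by move=> l; rewrite addr_gt0.
- rewrite -(addr0 0); apply: cvgD => //.
  by apply: cvg_geometric; rewrite gtr0_norm ?invr_gt0// invf_lt1// ltr1n.
move=> k l s a kl ps Fs ls a1.
have Ms j : restr F M (s j) by exact: restr_sub (Fs j).
have lM : (set_elt M l <= elt (s ord0) 0)%N.
  by rewrite (leq_trans _ ls)// set_elt_sub.
have s0 j : s j != fset0 by case: ps.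
have le0 j : (elt (s ord0) 0 <= elt (s j) 0)%N.
  have [->//|j0] := eqVneq j ord0.
  by case: ps => _ /(_ ord0 j 0%N) h _; apply: ltnW; apply: h;
    rewrite ?cardfs_gt0// lt0n.
(* In a plegma tuple [s ord0] starts first, so every element of every [s j] is some [g m] past
   [set_elt (range g) l], whence [l <= m]. *)
have gl j i : i \in s j -> (g l <= i)%N.
  move=> ij; have [m _ gm] := (proj2 (Fs j)) i ij.
  rewrite -gm (ltnW_homo g_homo)// (leq_set_elt_range g_homo)// gm.
  by rewrite (leq_trans ls)// (leq_trans (le0 j))// elt0_le.
have h1 := deltaP k l s a kl ps Ms lM a1.
rewrite (le_trans (ler_distD `|\sum_(j < k.+1) a j *: x (s j)| _ _))// addrC lerD//.
rewrite (le_trans (ler_dist_dist _ _))// -sumrB (le_trans (ler_norm_sum _ _ _))//.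
apply: (@le_trans _ _ (\sum_(j < k.+1) 8 * 4^-1 ^+ l)).
  apply: ler_sum => j _; rewrite -scalerBr normrZ distrC.
  rewrite -[leRHS]mul1r ler_pM ?normr_ge0 ?ler_norml//.
  by apply: xy => // i; exact: gl.
rewrite sumr_const card_ord -[leLHS]mulr_natl mulrCA ler_pM2l//.
rewrite (_ : 4^-1 = 2^-1 * 2^-1 :> R); last by field.
rewrite exprMn mulrA ler_piMl// ?exprn_ge0 ?invr_ge0//.
rewrite exprVn ler_pdivrMr ?exprn_gt0// mul1r -natrX ler_nat.
by rewrite (leq_ltn_trans kl)// ltn_expl.
Qed.

(** * Weak limits and the conclusion *)

Lemma weakly_convergent_functional (R : realType) (X : normedModType R)
    (F : set {fset nat}) (M : set nat) (x : {fset nat} -> X) (x0 : X)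
    (f : continuous_dual X) (e : R) : 0 < e -> weakly_convergent F M x x0 ->
  exists m, forall s, restr F M s -> (m <= elt s 0)%N ->
    `|(sval f (x s) : R) - sval f x0| <= e.
Proof.
move=> e0 x_x0; apply: (x_x0 [set y | `|(sval f y : R) - sval f x0| <= e]).
have idx : (id : X -> X) @ nbhs (x0 : weak X) --> (x0 : weak X) by exact: cvg_id.
have /cvgrPdistC_le/(_ e e0) := (@cvg_weak _ _ _ _ _ _ (nbhs_filter (x0 : weak X))).1 idx f.
exact.
Qed.

(** Sets with large minimum are close to [fset0], so this is continuity at [fset0]. *)
Lemma weakly_convergent_set0 (R : realType) (X : normedModType R)
    (F : set {fset nat}) (L : set nat) (x : {fset nat} -> X) :
  hat F fset0 ->
  {within restr (hat F) L : set fset_space, continuous (x : fset_space -> weak X)} ->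
  weakly_convergent F L x (x fset0).
Proof.
move=> F0 x_cont U xU.
have A0 : restr (hat F) L fset0 by split=> // i /=; rewrite in_fset0.
have /within_fset_space[m mP] := (subspace_continuousP _ _).1 x_cont fset0 A0 U xU.
exists m => s Fs ms; apply: mP; first exact: restr_hat.
move=> i im; rewrite in_fset0; apply/negP => /elt0_le.
by rewrite leqNgt (leq_trans im).
Qed.

Theorem theorem0p16 (R : realType) (X : completeNormedModType R)
    (b : nat -> X) (hb : schauder_basis b)
    (F : set {fset nat}) (hF : regular_thin F)
    (M : set nat) (hM : infinite_set M)
    (E : lmodType R) (p : E -> R) (hp : seminorm p)
    (e : nat -> E) (he : hamel_basis e)
    (x : {fset nat} -> X) (x0 : X)
    (hsub : subordinated F M x)
    (hconv : weakly_convergent F M x x0)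
    (hgen : generates F M x p e) :
  exists L : set nat, infinite_set L /\
  exists x' : {fset nat} -> X,
    [/\ subordinated F L x',
        weakly_convergent F L x' 0,
        plegma_disjointly_supported b F L x'
      & generates F L (fun s => x0 + x' s) p e].
Proof.
have F0 : hat F fset0.
  have [_ _ [s Fs _]] := hF; exists s => //.
  by have := below_initial_segment s 0; congr (initial_segment _ _);
     apply/fsetP => i; rewrite mem_below andbF in_fset0.
(* If the minima of the members of [F] inside [M] are bounded, a tail of [M] contains no member and
   the conclusion is vacuous there. *)
have [far|/existsNP[m mP]] :=
    pselect (forall m, exists2 s, restr F M s & (m <= elt s 0)%N); last first.
  pose L := M `&` [set n | (m <= n)%N].
  have noF s : ~ restr F L s.
    move=> Fs; apply: mP; exists s; first by apply: restr_sub Fs => n [].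
    have := elt0_in (regular_thin_neq0 hF (proj1 Fs)).
    by move=> /(proj2 Fs)[].
  exists L; split.
    apply/infinite_set_natP => n; have [k Mk] := (infinite_set_natP M).1 hM (maxn m n).
    by rewrite gtn_max => /andP[mk nk]; exists k => //; split=> //; exact: ltnW.
  exists (fun=> 0); split.
  - exists (fun=> 0); split=> // s.
    by apply: continuous_subspaceT; exact: cst_continuous.
  - by move=> U _; exists 0%N => s /noF.
  - by split=> [s /noF//|s /(_ ord0)/noF].
  - have [delta [delta0 delta_cvg _]] := hgen.
    by exists delta; split=> // k l s a _ _ /(_ ord0)/noF.
have [phi [phi_cont phi_x]] := hsub.
have A0 L : restr (hat F) L fset0 by split=> // i /=; rewrite in_fset0.
(* Both vectors are weak limits of [x s] as the minimum of [s] grows; [far] supplies such [s], and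
   the coordinates separate points. *)
have phi0 : phi fset0 = x0.
  apply: (coordinates_inj hb); apply/funext => n; pose f := coordinate_functional hb n.
  have near_f c : 0 < c -> `|(sval f (phi fset0) : R) - sval f x0| <= c.
    move=> c0; have c2 : 0 < c / 2 by rewrite divr_gt0.
    have [m1 m1P] := weakly_convergent_functional f c2 hconv.
    have phi_wc := weakly_convergent_set0 F0 phi_cont.
    have [m2 m2P] := weakly_convergent_functional f c2 phi_wc.
    have [s Fs] := far (maxn m1 m2); rewrite geq_max => /andP[ms1 ms2].
    have := m1P s Fs ms1; have := m2P s Fs ms2; rewrite (phi_x s Fs) => h2 h1.
    rewrite (le_trans (ler_distD (sval f (x s)) _ _))// [c]splitr lerD// distrC.
    exact: h2.
  apply/eqP; rewrite -subr_eq0 -normr_le0; apply/ler_addgt0Pr => c c0.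
  by rewrite add0r; exact: near_f.
have [g [N [g_homo gM N_le incr_near]]] := block_sequence hb phi_cont hM.
have gsubM : range g `<=` M by move=> _ [k _ <-].
have hump_cont : {within restr (hat F) (range g) : set fset_space,
    continuous (hump b phi g N : fset_space -> weak X)}.
  apply: (hump_weak_continuous hb g_homo incr_near).
  by apply: continuous_subspaceW phi_cont => s; exact: restr_sub.
exists (range g); split; first exact: infinite_range.
exists (hump b phi g N); split.
- by exists (hump b phi g N).
- rewrite -(hump_set0 hb phi g N); exact: weakly_convergent_set0.
- split=> [s _|s _ ps]; first exact: (hump_finite_supp hb phi g_homo N_le s).
  exact: (hump_plegma_disjoint hb phi g N_le ps).
- apply: (generates_perturb hM g_homo gsubM _ hgen) => l s Fs gs.
  have xs : x s = phi s by rewrite phi_x//; exact: (restr_sub gsubM Fs).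
  (* The difference to bound is [error s], compared with [error fset0 = 0]: the elements of [s] all
     being at least [g l], [s] and [fset0] agree below [g l]. *)
  rewrite xs -phi0 opprD addrA -/(error b phi g N s).
  rewrite -[error _ _ _ _ _]subr0 -(error_set0 hb phi g N).
  apply: (error_dist hb g_homo incr_near) => // [|i il].
    exact: restr_hat.
  rewrite in_fset0; apply/negP => /gs.
  by rewrite leqNgt il.
Qed.
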